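(* Let $G_n=\overline{C_n}$ for $n\ge 3$ be the graph complement of the cycle graph with $n$ vertices, let $G_2$ be the graph with two vertices and no edges, and for $n\ge 1$ let $G_n^+=\overline{L_n}$ be the graph complement of the path graph $L_n$ with $n$ vertices. Define polynomials recursively by $$f_n(t)=f_{n-1}(t)+t f_{n-2}(t)\ (n\ge 2),\quad f_0(t)=2,\ f_1(t)=1,$$ $$f_n^+(t)=f_{n-1}^+(t)+t f_{n-2}^+(t)\ (n\ge 1),\quad f_{-1}^+(t)=1,\ f_0^+(t)=1.$$ Then $f_n$ is the simplex generating function of $G_n$ for all $n\ge 2$, and $f_n^+$ is the simplex generating function of $G_n^+$ for all $n\ge 1$. These polynomials are given explicitly by $$f_n(t)=\frac{(1+\sqrt{4t+1})^n+(1-\sqrt{4t+1})^n}{2^n}\quad (n\ge 0),$$ $$f_n^+(t)=\frac{(1+\sqrt{4t+1})^{n+2}-(1-\sqrt{4t+1})^{n+2}}{2^{n+2}\sqrt{4t+1}}\quad (n\ge -1,\ t\ne -1/4).$$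
   Context: The simplex generating function of a finite simple graph $G$ is $f_G(t)=1+\sum_{k\ge 0} f_k(G)\,t^{k+1}$, where $f_k(G)$ is the number of complete subgraphs $K_{k+1}$ in $G$. *)

(* Defs.v *)
From mathcomp Require Import all_boot all_order all_algebra.
Set Implicit Arguments. Unset Strict Implicit. Unset Printing Implicit Defensive.
Import Order.TTheory GRing.Theory Num.Theory.
Local Open Scope ring_scope.

Record sgraph := SGraph {
  vertex :> finType;
  adj : rel vertex;
  adj_sym : symmetric adj;
  adj_irrefl : irreflexive adj }.

Section Complement.
Variable G : sgraph.

Definition compl_adj : rel G := fun x y => (x != y) && ~~ adj x y.

Lemma compl_adj_sym : symmetric compl_adj.
Proof. by move=> x y; rewrite /compl_adj eq_sym adj_sym. Qed.

Lemma compl_adj_irrefl : irreflexive compl_adj.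
Proof. by move=> x; rewrite /compl_adj eqxx. Qed.

Definition compl : sgraph := SGraph compl_adj_sym compl_adj_irrefl.
End Complement.

Definition edgeless_adj n : rel 'I_n := fun _ _ => false.

Lemma edgeless_adj_sym n : symmetric (@edgeless_adj n).
Proof. by []. Qed.

Lemma edgeless_adj_irrefl n : irreflexive (@edgeless_adj n).
Proof. by []. Qed.

Definition edgeless n : sgraph :=
  SGraph (@edgeless_adj_sym n) (@edgeless_adj_irrefl n).

(* The clause x != y only removes the loop that would appear for n = 1. *)
Definition cycle_adj n : rel 'I_n := fun x y =>
  (x != y) && ((x.+1 %% n == y)%N || (y.+1 %% n == x)%N).

Lemma cycle_adj_sym n : symmetric (@cycle_adj n).
Proof. by move=> x y; rewrite /cycle_adj eq_sym orbC. Qed.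

Lemma cycle_adj_irrefl n : irreflexive (@cycle_adj n).
Proof. by move=> x; rewrite /cycle_adj eqxx. Qed.

Definition cycle_graph n : sgraph :=
  SGraph (@cycle_adj_sym n) (@cycle_adj_irrefl n).

Definition path_adj n : rel 'I_n := fun x y =>
  (x.+1 == y)%N || (y.+1 == x)%N.

Lemma path_adj_sym n : symmetric (@path_adj n).
Proof. by move=> x y; rewrite /path_adj orbC. Qed.

Lemma path_adj_irrefl n : irreflexive (@path_adj n).
Proof. by move=> x; rewrite /path_adj orbb gtn_eqF. Qed.

Definition path_graph n : sgraph :=
  SGraph (@path_adj_sym n) (@path_adj_irrefl n).

(* Only meaningful for n >= 2. *)
Definition Gr n : sgraph :=
  if n is 2 then edgeless 2 else compl (cycle_graph n).

(* Only meaningful for n >= 1. *)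
Definition Grplus n : sgraph := compl (path_graph n).

Definition is_clique (G : sgraph) (A : {set G}) : bool :=
  [forall x in A, forall y in A, (x != y) ==> adj x y].

(* A complete subgraph K_{k+1} is determined by its k+1 vertices. *)
Definition nsimplices (G : sgraph) (k : nat) : nat :=
  #|[set A : {set G} | (#|A| == k.+1) && is_clique A]|.

Lemma nsimplices_eq0 (G : sgraph) (k : nat) :
  (#|G| <= k)%N -> nsimplices G k = 0%N.
Proof.
move=> le_Gk; apply/eqP; rewrite cards_eq0; apply/eqP/setP => A.
rewrite !inE; apply/negbTE; rewrite negb_and.
by rewrite neq_ltn ltnS (leq_trans (max_card _) le_Gk).
Qed.

(* The sum over all k >= 0 stops at #|G| by nsimplices_eq0. *)
Definition simplex_gf (G : sgraph) : {poly int} :=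
  1 + \sum_(k < #|G|) (nsimplices G k)%:R *: 'X^(k.+1).

Fixpoint fpoly (n : nat) : {poly int} :=
  match n with
  | 0 => 2
  | 1 => 1
  | (m.+1 as p).+1 => fpoly p + 'X * fpoly m
  end.

Lemma fpoly_rec (n : nat) :
  (2 <= n)%N -> fpoly n = fpoly (n - 1)%N + 'X * fpoly (n - 2)%N.
Proof. by case: n => [|[|n]] // _; rewrite subn1 subn2. Qed.

Fixpoint fplus_shift (m : nat) : {poly int} :=
  match m with
  | 0 => 1
  | 1 => 1
  | (k.+1 as p).+1 => fplus_shift p + 'X * fplus_shift k
  end.

(* Indices start at -1; values at n < -1 are junk. *)
Definition fplus (n : int) : {poly int} := fplus_shift (absz (n + 1)).

Lemma fplusN1 : fplus (-1) = 1.
Proof. by []. Qed.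

Lemma fplus0 : fplus 0 = 1.
Proof. by []. Qed.

Lemma fplus_rec (n : int) :
  1 <= n -> fplus n = fplus (n - 1) + 'X * fplus (n - 2).
Proof.
case: n => [[|n]|] // _; rewrite /fplus.
have -> : n.+1%:Z - 1 + 1 = n.+1%:Z by rewrite subrK.
have -> : n.+1%:Z - 2 + 1 = n%:Z by rewrite -addrA -addn1 PoszD addrK.
by rewrite -PoszD addn1.
Qed.

(* Main.v *)
Require Import Defs.
From mathcomp Require Import all_boot all_order all_algebra.
From mathcomp Require Import zify ring.
Set Implicit Arguments. Unset Strict Implicit. Unset Printing Implicit Defensive.
Import Order.TTheory GRing.Theory Num.Theory.
Local Open Scope ring_scope.

(** The simplex generating function of a graph counts its cliques, the empty
    one included, by size.  Sorting the cliques by whether they contain a given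
    vertex [v] yields the deletion rule [clique_poly_del]

      f_G = f_{G - v} + t f_{lk v},

    where the link [lk v] is the subgraph induced on the neighbours of [v].

    In the complement of a path the neighbours of the last vertex are all the
    vertices except itself and its predecessor.  Both [G - v] and [lk v] are
    therefore complements of shorter paths, with one and two vertices fewer,
    and the rule is the recursion of [fplus].  In the complement of a cycle
    with [n] vertices, deleting a vertex leaves the complement of a path with
    [n - 1] vertices, and its link is the complement of a path with [n - 3]
    vertices; hence f_n = f^+_{n-1} + t f^+_{n-3}, which also follows from the
    two recursions alone ([fpoly_fplus_shift]).  The induced subgraphs that
    occur are all carried by intervals of the original vertex set, so
    [clique_poly_interval] treats the two families at once.

    The explicit formulas hold because (1 + s) / 2 and (1 - s) / 2, where
    s ^ 2 = 4 t + 1, are the roots of x ^ 2 = x + t: every combination of their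
    [n]-th powers satisfies the recursion, and the initial values agree. *)

(** * Second-order recursions *)

Lemma rec2_unique (R : pzRingType) (t : R) (u v : nat -> R) :
    (forall n, u n.+2 = u n.+1 + t * u n) ->
    (forall n, v n.+2 = v n.+1 + t * v n) ->
    u 0%N = v 0%N -> u 1%N = v 1%N ->
  u =1 v.
Proof.
move=> uS vS uv0 uv1 n; suff [] : u n = v n /\ u n.+1 = v n.+1 by [].
by elim: n => [|n [IH0 IH1]]; split=> //; rewrite uS vS IH0 IH1.
Qed.

(** * The clique polynomial and the deletion rule *)

(** Relative to a vertex set, so that deletions and links are again of this
    form without any change of vertex type. *)
Definition clique_poly (G : sgraph) (S : {set G}) : {poly int} :=
  \sum_(A : {set G} | (A \subset S) && is_clique A) 'X^#|A|.

Lemma is_cliqueP (G : sgraph) (A : {set G}) :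
  reflect {in A &, forall x y, x != y -> adj x y} (is_clique A).
Proof.
apply: (iffP forall_inP) => [cA x y xA yA | cA x xA].
  by move/forall_inP/(_ y yA)/implyP: (cA x xA).
by apply/forall_inP => y yA; apply/implyP; apply: cA.
Qed.

Lemma is_clique0 (G : sgraph) : is_clique (set0 : {set G}).
Proof. by apply/is_cliqueP => x y; rewrite inE. Qed.

Lemma is_cliqueU1 (G : sgraph) (v : G) (B : {set G}) :
  v \notin B -> is_clique (v |: B) = (B \subset [set w | adj v w]) && is_clique B.
Proof.
move=> vB; apply/is_cliqueP/andP => [cB | [/subsetP sB /is_cliqueP cB] x y].
  split.
    apply/subsetP => w wB; rewrite inE cB ?setU11 ?setU1r //.
    by apply: contraNneq vB => ->.
  by apply/is_cliqueP => x y xB yB; apply: cB; apply: setU1r.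
move=> /setU1P[->|xB] /setU1P[->|yB]; rewrite ?eqxx // => xy.
- by have := sB y yB; rewrite inE.
- by have := sB x xB; rewrite inE adj_sym.
- exact: cB.
Qed.

Lemma clique_poly0 (G : sgraph) : clique_poly (set0 : {set G}) = 1.
Proof.
rewrite /clique_poly (big_pred1 set0) ?cards0 ?expr0 // => A /=.
by rewrite subset0; case: eqP => // ->; rewrite is_clique0.
Qed.

(** Erasing [v] maps the cliques through [v] bijectively to the cliques of its
    link, and lowers the size by one. *)
Lemma clique_poly_del (G : sgraph) (S : {set G}) (v : G) : v \in S ->
  clique_poly S =
    clique_poly (S :\ v) + 'X * clique_poly (S :&: [set w | adj v w]).
Proof.
move=> vS; rewrite /clique_poly (bigID (fun A : {set G} => v \in A)) /= addrC.
congr (_ + _).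
  by apply: eq_bigl => A; rewrite subsetD1 -andbA [is_clique A && _]andbC andbA.
rewrite big_distrr /=.
have notin_link (B : {set G}) : B \subset S :&: [set w | adj v w] -> v \notin B.
  by move/subsetP => sB; apply/negP => /sB; rewrite !inE adj_irrefl andbF.
rewrite (reindex_onto (fun B => v |: B) (fun A => A :\ v)) /=; last first.
  by move=> A /andP[_ vA]; rewrite setD1K.
apply: eq_big => [B | B /andP[/andP[_ _] /eqP vB]]; last first.
  have {}vB : v \notin B by rewrite -vB setD11.
  by rewrite cardsU1 vB exprS.
have [vB | vB] := boolP (v \in B).
  rewrite [in RHS](contraTF (@notin_link B)) ?vB //= [_ :\ v == _]negbTE ?andbF //.
  by apply: contraTneq vB => <-; rewrite setD11.
rewrite setU11 setU1K // eqxx !andbT is_cliqueU1 // subUset sub1set vS /=.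
by rewrite subsetI andbA.
Qed.

Lemma simplex_gfE (G : sgraph) : simplex_gf G = clique_poly [set: G].
Proof.
rewrite /clique_poly /simplex_gf.
rewrite (partition_big (fun A : {set G} => inord #|A| : 'I_#|G|.+1) predT) //=.
have inordE (A : {set G}) (k : 'I_#|G|.+1) : (inord #|A| == k) = (#|A| == k).
  by rewrite -val_eqE /= inordK // ltnS max_card.
rewrite big_ord_recl; congr (_ + _).
  rewrite (big_pred1 set0) ?cards0 ?expr0 // => A /=.
  rewrite subsetT inordE /= cards_eq0.
  by case: eqP => [->|]; rewrite ?is_clique0 ?andbF.
apply: eq_bigr => k _; rewrite /nsimplices -sum1_card natr_sum scaler_suml.
apply: eq_big => [A | A]; first by rewrite inE subsetT inordE /= andbC.
by rewrite inE => /andP[/eqP -> _]; rewrite scale1r.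
Qed.

(** * Complements of paths and cycles *)

Definition interval n (a m : nat) : {set 'I_n} :=
  [set i : 'I_n | (a <= i < a + m)%N].

(** Only the adjacency inside the interval matters, so the lemma applies both
    to the complement of a path and to the part of the complement of a cycle
    that remains once a vertex is deleted. *)
Lemma clique_poly_interval n (e : rel 'I_n)
    (e_sym : symmetric e) (e_irrefl : irreflexive e) (a m : nat) :
    (a + m <= n)%N ->
    (forall x y : 'I_n, (a <= x)%N -> (x < y < a + m)%N ->
       e y x = (x.+1 != y)) ->
  clique_poly (interval n a m : {set SGraph e_sym e_irrefl}) =
    fplus_shift m.+1.
Proof.
set G := SGraph e_sym e_irrefl.
elim/ltn_ind: m => -[_ _ _|m IH le_n eE].
  rewrite [interval n a 0](_ : _ = set0) ?clique_poly0 //.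
  by apply/setP => i; rewrite !inE; lia.
have v_lt : (a + m < n)%N by lia.
pose v := Ordinal v_lt.
rewrite (@clique_poly_del G _ v); last by rewrite inE /=; lia.
rewrite [_ :\ _](_ : _ = interval n a m); last first.
  by apply/setP => i; rewrite !inE -val_eqE /=; lia.
rewrite [_ :&: _](_ : _ = interval n a m.-1); last first.
  apply/setP => i; rewrite !inE.
  have [/andP[ai im] | ] := boolP (a <= i < a + m)%N.
    by rewrite /= eE //=; lia.
  have [<-|] := eqVneq v i; first by rewrite /= e_irrefl /=; lia.
  by rewrite -val_eqE /=; lia.
have IHe k : (k <= m)%N ->
    clique_poly (interval n a k : {set G}) = fplus_shift k.+1.
  move=> le_km; apply: IH; [lia | lia | move=> x y ax xy; apply: eE; lia].
(* For m = 0 the link is empty, and so is the interval of length m.-1; the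
   recursion still fits since fplus_shift takes the same value at 0 and 1. *)
by rewrite !IHe //; [case: (m) | lia].
Qed.

Lemma interval_full n : interval n 0 n = [set: 'I_n].
Proof. by apply/setP => i; rewrite !inE add0n ltn_ord. Qed.

Lemma simplex_gf_compl_path n : simplex_gf (Grplus n) = fplus_shift n.+1.
Proof.
rewrite simplex_gfE -(@clique_poly_interval n (@compl_adj (path_graph n))
  (@compl_adj_sym (path_graph n))
  (@compl_adj_irrefl (path_graph n)) 0 n) // ?interval_full //.
by move=> x y _ xy; rewrite /compl_adj /= /path_adj -val_eqE /=; lia.
Qed.

Lemma fpoly_fplus_shift n :
  fpoly n.+2 = fplus_shift n.+2 + 'X * fplus_shift n.
Proof.
have fpoly2 : fpoly 2 = fplus_shift 2 + 'X * fplus_shift 0.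
  by rewrite /= mulrDr addrA.
move: n; apply: (@rec2_unique _ 'X) => [//|n|//|].
  have fplusS k : fplus_shift k.+2 = fplus_shift k.+1 + 'X * fplus_shift k by [].
  by rewrite (fplusS n.+2) (fplusS n) !mulrDr addrACA.
by rewrite [fpoly 3]/(fpoly 2 + 'X * 1) fpoly2 addrAC.
Qed.

Lemma simplex_gf_compl_cycle n :
  simplex_gf (compl (cycle_graph n.+3)) =
    fplus_shift n.+3 + 'X * fplus_shift n.+1.
Proof.
set G := compl _.
rewrite simplex_gfE (@clique_poly_del G _ (ord_max : 'I_n.+3)) ?inE //.
set e := @compl_adj (cycle_graph n.+3).
(* Away from the last vertex no successor wraps around. *)
have eE (x y : 'I_n.+3) : (x < y < n.+2)%N -> e y x = (x.+1 != y).
  move=> xy; rewrite /e /compl_adj /= /cycle_adj -val_eqE /=.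
  by rewrite !modn_small; lia.
have e_last (x : 'I_n.+3) : e ord_max x = (1 <= x < n.+1)%N.
  rewrite /e /compl_adj /= /cycle_adj -val_eqE /= modnn.
  have [x_lt|x_ge] := ltnP x n.+2; first by rewrite modn_small; lia.
  have xE : x = n.+2 :> nat by have := ltn_ord x; lia.
  by rewrite xE eqxx /=; lia.
congr (_ + 'X * _).
  rewrite -(@clique_poly_interval n.+3 e
    (@compl_adj_sym (cycle_graph n.+3))
    (@compl_adj_irrefl (cycle_graph n.+3)) 0 n.+2) //; last first.
    by move=> x y _ xy; apply: eE.
  congr (clique_poly _); apply/setP => i.
  by rewrite !inE -val_eqE /=; have := ltn_ord i; lia.
rewrite -(@clique_poly_interval n.+3 e
  (@compl_adj_sym (cycle_graph n.+3))
  (@compl_adj_irrefl (cycle_graph n.+3)) 1 n) //; first last.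
- by move=> x y _ xy; apply: eE; lia.
- lia.
by congr (clique_poly _); apply/setP => i; rewrite !inE [adj _ _]e_last.
Qed.

(** Two vertices without an edge also form the complement of the path on two
    vertices, so the interval lemma covers the case in which no cycle exists. *)
Lemma simplex_gf_edgeless2 : simplex_gf (edgeless 2) = fplus_shift 3.
Proof.
rewrite simplex_gfE -(@clique_poly_interval 2 (@edgeless_adj 2)
  (@edgeless_adj_sym 2) (@edgeless_adj_irrefl 2) 0 2) // ?interval_full //.
by move=> x y _ xy; rewrite /edgeless_adj; lia.
Qed.

(** * Explicit formulas *)

Lemma expr_rec2 (R : comPzRingType) (t x : R) n :
  x ^+ 2 = x + t -> x ^+ n.+2 = x ^+ n.+1 + t * x ^+ n.
Proof. by move=> x2; rewrite -addn2 exprD x2 mulrDr -exprSr [t * _]mulrC. Qed.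

Lemma half_root (F : numFieldType) (t s : F) :
  s ^+ 2 = 4 * t + 1 -> ((1 + s) / 2) ^+ 2 = (1 + s) / 2 + t.
Proof.
move=> s2; have -> : t = (s ^+ 2 - 1) / 4 by rewrite s2; field.
by field.
Qed.

Lemma half_root_conj (F : numFieldType) (t s : F) :
  s ^+ 2 = 4 * t + 1 -> ((1 - s) / 2) ^+ 2 = (1 - s) / 2 + t.
Proof. by move=> s2; apply: half_root; rewrite sqrrN. Qed.

Lemma fpoly_closed (F : numFieldType) (t s : F) n : s ^+ 2 = 4 * t + 1 ->
  (map_poly intr (fpoly n)).[t] = ((1 + s) ^+ n + (1 - s) ^+ n) / 2 ^+ n.
Proof.
move=> s2; rewrite mulrDl -!expr_div_n; move: n.
apply: (@rec2_unique _ t) => [n|n||].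
- by rewrite rmorphD rmorphM /= map_polyX !hornerE.
- rewrite (expr_rec2 n (half_root s2)) (expr_rec2 n (half_root_conj s2)); ring.
- by rewrite /= rmorph_nat hornerMn hornerC !expr0.
- by rewrite /= rmorph1 hornerC; field.
Qed.

Lemma fplus_shift_closed (F : numFieldType) (t s : F) m :
    s ^+ 2 = 4 * t + 1 -> s != 0 ->
  (map_poly intr (fplus_shift m)).[t] =
    ((1 + s) ^+ m.+1 - (1 - s) ^+ m.+1) / (2 ^+ m.+1 * s).
Proof.
move=> s2 s0; rewrite invfM mulrA mulrBl -!expr_div_n; move: m.
apply: (@rec2_unique _ t) => [n|n||].
- by rewrite rmorphD rmorphM /= map_polyX !hornerE.
- rewrite (expr_rec2 n.+1 (half_root s2)) (expr_rec2 n.+1 (half_root_conj s2)).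
  ring.
- by rewrite /= rmorph1 hornerC; field.
- by rewrite /= rmorph1 hornerC; field.
Qed.

Theorem lemma1 :
  [/\ (forall n : nat, (2 <= n)%N -> fpoly n = simplex_gf (Gr n)),
      (forall n : nat, (1 <= n)%N -> fplus n%:Z = simplex_gf (Grplus n)),
      (forall (C : numClosedFieldType) (t : C) (n : nat),
         (map_poly intr (fpoly n)).[t] =
           ((1 + sqrtC (4 * t + 1)) ^+ n + (1 - sqrtC (4 * t + 1)) ^+ n)
             / 2 ^+ n)
    & (forall (C : numClosedFieldType) (t : C) (n : int),
         -1 <= n -> t != - (1 / 4) ->
         (map_poly intr (fplus n)).[t] =
           ((1 + sqrtC (4 * t + 1)) ^ (n + 2)
              - (1 - sqrtC (4 * t + 1)) ^ (n + 2))
             / (2 ^ (n + 2) * sqrtC (4 * t + 1)))].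
Proof.
split=> [n n_ge2|n n_ge1|C t n|C t n n_ge t_neq].
- case: n n_ge2 => [|[|[|n]]] // _; rewrite fpoly_fplus_shift.
    by rewrite simplex_gf_edgeless2.
  by rewrite simplex_gf_compl_cycle.
- by rewrite simplex_gf_compl_path /fplus -PoszD addn1.
- by apply: fpoly_closed; rewrite sqrtCK.
have s_neq0 : sqrtC (4 * t + 1) != 0.
  rewrite sqrtC_eq0; apply: contra_neq t_neq => t0.
  have -> : t = (4 * t + 1) / 4 - 1 / 4 by field.
  by rewrite t0 mul0r sub0r.
have [m ->] : exists m : nat, n = m%:Z - 1 by exists (absz (n + 1)); lia.
have -> : m%:Z - 1 + 2 = m.+1%:Z by lia.
by rewrite /fplus subrK; apply: fplus_shift_closed; rewrite ?sqrtCK.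
Qed.
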